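(* If $A,B$ are Banach-Saks sets in Schreier's space $S$, then $A\otimes B$ is a Banach-Saks set in $S\otimes_\pi S$.
   Context: A finite subset $A=\{n_1<\cdots<n_k\}$ of $\mathbb{N}=\{1,2,\dots\}$ is admissible if $k\le n_1$. Schreier's space $S$ is the completion of the space $c_{00}$ of finitely supported scalar sequences under the norm $\|x\|_S=\sup\{\sum_{j\in A}|x_j| : A\subset\mathbb{N}\text{ admissible}\}$. $S\otimes_\pi S$ denotes the (completed) projective tensor product, and $A\otimes B=\{a\otimes b: a\in A,\ b\in B\}$. A subset of a Banach space is a Banach-Saks set if every sequence in it has a subsequence whose arithmetic means converge in norm. *)

(* Defs.v *)
From HB Require Import structures.
From mathcomp Require Import all_boot all_order all_algebra finmap.
From mathcomp Require Import all_classical all_reals all_analysis.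
From mathcomp Require Import complex.
Import Order.TTheory GRing.Theory Num.Theory.
Import numFieldNormedType.Exports.

Set Implicit Arguments.
Unset Strict Implicit.
Unset Printing Implicit Defensive.

Local Open Scope classical_set_scope.
Local Open Scope ring_scope.

Definition real_or_complex (R : realType) (K : numFieldType) : Prop :=
  K = (R : numFieldType) \/ K = (R[i] : numFieldType).

(* [S] is the completion of the normed space [(V, N)] via the embedding [f]. *)
Definition is_completion (K : numFieldType) (V : lmodType K) (N : V -> K)
    (S : completeNormedModType K) (f : {linear V -> S}) : Prop :=
  (forall v, `|f v| = N v) /\ dense (range f).

Definition banach_saks (K : numFieldType) (X : normedModType K) (A : set X) :
    Prop :=
  forall x : nat -> X, (forall n, A (x n)) ->
  exists phi : nat -> nat, {homo phi : m n / (m < n)%N} /\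
    cvgn (fun n => n.+1%:R^-1 *: \sum_(k < n.+1) x (phi k) : X).

Section C00.
Variable K : numFieldType.

Definition finitely_supported : {pred nat -> K^o} :=
  fun x => `[< exists N, forall n, (N <= n)%N -> x n = 0 >].

Lemma finitely_supported_submod : submod_closed finitely_supported.
Proof.
split=> [|a x y /asboolP[M xM] /asboolP[N yN]].
  by apply/asboolP; exists 0%N.
apply/asboolP; exists (maxn M N) => n.
by rewrite geq_max => /andP[Mn Nn]; change (a *: x n + y n = 0); rewrite xM// yN// scaler0 addr0.
Qed.

HB.instance Definition _ := GRing.isSubmodClosed.Build K (nat -> K^o)
  finitely_supported finitely_supported_submod.

Record c00 := C00 { c00_val :> nat -> K^o ; _ : c00_val \in finitely_supported }.

HB.instance Definition _ := [isSub for c00_val].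
HB.instance Definition _ := [Choice of c00 by <:].
HB.instance Definition _ := [SubChoice_isSubLmodule of c00 by <:].

(* The index [n : nat] stands for the positive integer [n.+1], and
   #|A| <= min A is stated as #|A| <= every element of A. *)
Definition admissible (A : {fset nat}) : Prop :=
  forall n, n \in A -> (#|` A| <= n.+1)%N.

(* The order of R[i] compares only numbers with the same imaginary part, so a
   supremum or infimum of a set of reals in R[i] is the one taken in R. *)
Definition schreier_norm (x : c00) : K :=
  supremum 0 [set \sum_(j <- A) `|x j| | A in admissible].

End C00.

Section Tensor.
Variables (K : numFieldType) (X Y : normedModType K).

Definition bilinear_form := {bilinear X -> Y -> K | *%R & *%R}.

(* The algebraic tensor product is the space of functionals on the bilinear
   forms spanned by the evaluations x ⊗ y : f |-> f x y. *)
Definition eval_form (x : X) (y : Y) : bilinear_form -> K^o := fun f => f x y.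

Definition spanned_by_eval : {pred bilinear_form -> K^o} :=
  fun u => `[< exists s : seq (X * Y), u = \sum_(p <- s) eval_form p.1 p.2 >].

Lemma spanned_by_eval_submod : submod_closed spanned_by_eval.
Proof.
split=> [|a u v /asboolP[s ->] /asboolP[t ->]].
  by apply/asboolP; exists [::]; rewrite big_nil.
apply/asboolP; exists ([seq (a *: p.1, p.2) | p <- s] ++ t).
rewrite big_cat big_map/= scaler_sumr; congr (_ + _).
apply: eq_bigr => p _; apply/funext => f.
by rewrite /eval_form/= linearZl_LR.
Qed.

HB.instance Definition _ := GRing.isSubmodClosed.Build K
  (bilinear_form -> K^o) spanned_by_eval spanned_by_eval_submod.

Record tensor := Tensor {
  tensor_val :> bilinear_form -> K^o ; _ : tensor_val \in spanned_by_eval }.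

HB.instance Definition _ := [isSub for tensor_val].
HB.instance Definition _ := [Choice of tensor by <:].
HB.instance Definition _ := [SubChoice_isSubLmodule of tensor by <:].

Lemma eval_form_spanned x y : eval_form x y \in spanned_by_eval.
Proof. by apply/asboolP; exists [:: (x, y)]; rewrite big_seq1. Qed.

Definition pure_tensor (x : X) (y : Y) : tensor := Tensor (eval_form_spanned x y).

Definition projective_norm (u : tensor) : K :=
  infimum 0 [set \sum_(p <- s) `|p.1| * `|p.2| |
    s in [set s : seq (X * Y) | u = \sum_(p <- s) pure_tensor p.1 p.2]].

End Tensor.

(* Main.v *)
Require Import Defs.
From HB Require Import structures.
From mathcomp Require Import all_boot all_order all_algebra finmap zify ring.
From mathcomp Require Import all_classical all_reals all_analysis.
From mathcomp Require Import complex.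
Import Order.TTheory GRing.Theory Num.Theory.
Import numFieldNormedType.Exports.

Local Open Scope classical_set_scope.
Local Open Scope ring_scope.

(* After passing to a subsequence, every sequence in a Banach-Saks set of
   Schreier's space is z + y_n, where all the sums of a_n y_n with |a_n| <= 1
   are bounded. Indeed, along a free ultrafilter the coordinates of y_n tend to
   0 for a suitable z, and then so does the sup norm: otherwise some
   subsequence has coordinates of size at least d moving to infinity, and the
   Cesaro means of orders M and 2M of any further subsequence differ by about
   d/2 on an admissible set. A sequence that tends to 0 fast enough in sup norm
   relative to the supports of its predecessors behaves like the basis of c_0,
   because an admissible set that meets a given support has at most as many
   elements as the largest index in that support.
   With x_n = z + y_n and x'_n = z' + y'_n, the sum of the y_n (x) y'_n is the
   average over signs of the products of the sums of e_n y_n and of e_n y'_n,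
   hence bounded, and the cross terms are bounded too; so the means of the
   x_n (x) x'_n tend to z (x) z'. *)

(** * Suprema, infima and ultrafilter limits of real or complex scalars *)

Lemma nonneg_supremums (R : realType) (K : numFieldType) (E : set K) (M : K) :
  real_or_complex R K -> E !=set0 -> (forall x, E x -> 0 <= x <= M) ->
  supremums E !=set0.
Proof.
move=> hK; case: hK E M => -> E M [x0 Ex0] EM.
  have Esup : has_sup E.
    by split; [exists x0 | exists M => x /EM/andP[]].
  exists (sup E); split; first exact/ubP/sup_upper_bound.
  by move=> y Ey; apply: ge_sup => //; exists x0.
(* Nonnegative elements of [R[i]] are real, so real parts lose nothing. An upper bound [y] of [E] is
   itself real, being above the nonnegative [x0]. *)
pose F : set R := [set complex.Re x | x in E].
have ReE (x : R[i]) : 0 <= x -> x = (complex.Re x)%:C%C.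
  by move=> /ger0_real/RRe_real.
have Fsup : has_sup F.
  split; first by exists (complex.Re x0), x0.
  exists (complex.Re M) => _ [x Ex <-]; have /andP[_] := EM _ Ex.
  by rewrite lecE => /andP[].
exists (sup F)%:C%C; split=> [x Ex|y yE].
  have /andP[x0' _] := EM _ Ex; rewrite (ReE _ x0') lecR.
  by apply: sup_upper_bound => //; exists x.
have y0 : 0 <= y by rewrite (le_trans _ (yE _ Ex0))//; case/andP: (EM _ Ex0).
rewrite (ReE _ y0) lecR; apply: ge_sup; first by exists (complex.Re x0), x0.
by move=> _ [x Ex <-]; have := yE _ Ex; rewrite lecE => /andP[].
Qed.

(** The infimum is the supremum of the nonnegative lower bounds. A lower bound outside that set is
    comparable with [x0], hence real, hence negative. *)
Lemma nonneg_infimums (R : realType) (K : numFieldType) (E : set K) :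
  real_or_complex R K -> E !=set0 -> (forall x, E x -> 0 <= x) ->
  infimums E !=set0.
Proof.
move=> hK [x0 Ex0] E0.
pose L := [set y : K | 0 <= y /\ lbound E y].
have LE y x : L y -> E x -> y <= x by case=> _; apply.
have [||s [ubs lubs]] := nonneg_supremums R K L x0 hK.
- by exists 0; split => // y /E0.
- by move=> y Ly; rewrite (LE _ _ Ly Ex0); case: Ly => ->.
exists s; split=> [x Ex|y Ey].
  by apply: lubs => y Ly; exact: LE.
have [y0|y0] := boolP (0 <= y); first by apply: ubs.
have s0 : 0 <= s by apply: ubs; split => // y' /E0.
have xy := Ey _ Ex0.
have yr : y \is Num.real by rewrite (ler_real xy) ger0_real// E0.
by move: y0; rewrite -real_ltNge// => [/ltW/le_trans->].
Qed.

Lemma real_or_complex_archimedean (R : realType) (K : numFieldType) (e : K) :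
  real_or_complex R K -> 0 < e -> exists N, N.+1%:R^-1 < e.
Proof.
have key (x : R) : 0 < x -> exists N, N.+1%:R^-1 < x.
  move=> x0; exists (Num.bound x^-1).
  rewrite invf_plt ?posrE//.
  by rewrite (lt_trans (archi_boundP _)) ?invr_ge0 ?ltW// ltr_nat.
move=> hK; case: hK e => -> e e0; first exact: key.
have eE : (complex.Re e)%:C%C = e by apply/RRe_real/ger0_real/ltW.
rewrite -eE -{1}(rmorph0 (real_complex R)) ltcR in e0 *.
have [N Ne] := key _ e0; exists N.
by rewrite -(rmorph_nat (real_complex R)) -fmorphV ltcR.
Qed.

Lemma ultra_limit (R : realType) (K : numFieldType) (U : set_system nat)
    (u : nat -> K) (M : K) :
  real_or_complex R K -> UltraFilter U -> (forall n, `|u n| <= M) ->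
  exists l, forall e, 0 < e -> U [set n | `|u n - l| < e].
Proof.
move=> hK FU.
have key (v : nat -> R) (B : R) : (forall n, `|v n| <= B) ->
    exists l, forall e, 0 < e -> U [set n | `|v n - l| < e].
  move=> vB; have := @segment_compact R (- B) B => /(_ (v @ U) _) [].
    rewrite /fmap /=; apply: filterS (@filterT _ U _) => n _ /=.
    by rewrite in_itv/= -ler_norml.
  move=> l [_ vl]; exists l => e e0.
  (* Compactness gives a cluster point [l]. For an ultrafilter it is a limit: otherwise the
     complement of a ball preimage would be in [U] and [l] could not be a cluster point. *)
  have [//|Unl] := in_ultra_setVsetC [set n | `|v n - l| < e] FU.
  have [_ [[n nl <-]]] := vl (v @` (~` [set n | `|v n - l| < e])) _
    (filterS (@preimage_image _ _ v _) Unl) (nbhsx_ballx l e e0).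
  by move=> nle; case: nl; rewrite /= distrC.
case: hK u M => -> u M uM; first exact: key uM.
have ReM n : `|complex.Re (u n)| <= complex.Re M.
  have := le_trans (normc_ge_Re (u n)) (uM n).
  by rewrite lecE => /andP[].
have ImM n : `|complex.Im (u n)| <= complex.Re M.
  (* The imaginary part is, up to sign, the real part of [u n * 'i], and ['i] has modulus 1. *)
  have := le_trans (normc_ge_Re (u n * 'i%C)) _.
  move=> /(_ M); rewrite normrM ReiNIm normrN.
  rewrite [X in _ * X](_ : _ = 1) ?mulr1; last first.
    by rewrite normc_def/= expr0n/= add0r expr1n sqrtr1.
  by move=> /(_ (uM n)); rewrite lecE => /andP[].
have [a al] := key _ _ ReM; have [b bl] := key _ _ ImM.
exists (a +i* b)%C => e e0.
have eE : (complex.Re e)%:C%C = e by apply/RRe_real/ger0_real/ltW.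
have e20 : 0 < complex.Re e / 2.
  by rewrite divr_gt0//; move: e0; rewrite ltcE => /andP[].
apply: filterS2 (al _ e20) (bl _ e20) => n na nb /=.
rewrite (_ : u n - _ =
    (complex.Re (u n) - a)%:C%C + 'i%C * (complex.Im (u n) - b)%:C%C); last first.
  by rewrite [LHS]complexE/=; case: (u n).
rewrite (le_lt_trans (ler_normD _ _))// normrM.
have Rn (x : R) : `|x%:C%C| = `|x|%:C%C.
  by rewrite normc_def/= expr0n/= addr0 sqrtr_sqr.
rewrite [X in X * _](_ : _ = 1) ?mul1r; last first.
  by rewrite normc_def/= expr0n/= add0r expr1n sqrtr1.
by rewrite !Rn -rmorphD/= -eE ltcR [ltRHS]splitr ltrD.
Qed.

(** * The Schreier norm, completions and the projective norm *)

Lemma c00_bound (K : numFieldType) (v : c00 K) :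
  exists N, forall n, (N <= n)%N -> v n = 0.
Proof. by case: v => v vf; have /asboolP := vf. Qed.

Lemma c00_sumE (K : numFieldType) (I : Type) (s : seq I) (P : pred I)
    (u : I -> c00 K) j :
  (\sum_(k <- s | P k) u k) j = \sum_(k <- s | P k) u k j.
Proof. by elim/big_ind2 : _ => // x y x' y' <- <-. Qed.

(** [supremum] falls back to a default when there is no least upper bound. One exists here because
    the finite sum of all [|v j|] bounds every admissible sum. *)
Lemma schreier_normP (R : realType) (K : numFieldType) (v : c00 K) :
  real_or_complex R K ->
  supremums [set \sum_(j <- A) `|v j| | A in admissible] (schreier_norm v).
Proof.
move=> hK; set E := [set _ | _ in _].
have E0 : E !=set0.
  by exists (\sum_(j <- fset0) `|v j|), fset0 => // n; rewrite inE.
rewrite /schreier_norm /supremum -/E; case: eqP E0 => [->[]//|_ E0].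
apply: xgetPex; have [N vN] := c00_bound _ v.
apply: (nonneg_supremums R K E (\sum_(0 <= j < N) `|v j|) hK E0).
move=> _ [A _ <-]; apply/andP; split; first exact: sumr_ge0.
rewrite (bigID (fun j => j < N)%N)/= [X in _ + X]big1 ?addr0; last first.
  by move=> j; rewrite -leqNgt => /vN->; rewrite normr0.
rewrite [leRHS](bigID (fun j => j \in A))/= -[leLHS]addr0 lerD ?sumr_ge0//.
rewrite -big_filter -[leRHS]big_filter le_eqVlt; apply/orP; left; apply/eqP.
apply/perm_big/uniq_perm; rewrite ?filter_uniq ?iota_uniq ?fset_uniq// => j.
by rewrite !mem_filter mem_index_iota andbC.
Qed.

Lemma schreier_sum_le (R : realType) (K : numFieldType)
    (S : completeNormedModType K) (i : {linear c00 K -> S}) (s : seq nat)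
    (v : c00 K) :
  real_or_complex R K -> is_completion (@schreier_norm K) i -> uniq s ->
  (forall n, n \in s -> (size s <= n.+1)%N) -> \sum_(j <- s) `|v j| <= `|i v|.
Proof.
move=> hK [-> _] us sle; have [+ _] := schreier_normP R K v hK.
apply; exists (seq_fset tt s) => [n|].
  by rewrite size_seq_fset undup_id// seq_fsetE => /sle.
by apply: perm_big; rewrite (perm_trans (seq_fset_perm _ _))// undup_id.
Qed.

Lemma schreier_coord_le (R : realType) (K : numFieldType)
    (S : completeNormedModType K) (i : {linear c00 K -> S}) (v : c00 K) j :
  real_or_complex R K -> is_completion (@schreier_norm K) i -> `|v j| <= `|i v|.
Proof.
move=> hK hS; have := schreier_sum_le R K S i [:: j] v hK hS isT.
by rewrite big_seq1; apply => n; rewrite inE => /eqP->.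
Qed.

Lemma schreier_norm_le (R : realType) (K : numFieldType)
    (S : completeNormedModType K) (i : {linear c00 K -> S}) (v : c00 K) C :
  real_or_complex R K -> is_completion (@schreier_norm K) i ->
  (forall A, admissible A -> \sum_(j <- A) `|v j| <= C) -> `|i v| <= C.
Proof.
move=> hK [-> _] vC; have [_] := schreier_normP R K v hK.
by apply=> _ [A /vC ? <-].
Qed.

Lemma completion_approx (K : numFieldType) (V : lmodType K) (N : V -> K)
    (S : completeNormedModType K) (f : {linear V -> S}) (x : S) e :
  is_completion N f -> 0 < e -> exists v, `|x - f v| <= e.
Proof.
move=> [_ fd] e0; have [||y [xf [v _ vE]]] := fd (ball x e).
- by exists x; exact: ballxx.
- exact: ball_open.
by exists v; move: xf; rewrite -vE -ball_normE/= => /ltW.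
Qed.

(** The one-term representation [[:: (x, y)]] takes part in the infimum. *)
Lemma projective_pure_le (R : realType) (K : numFieldType)
    (X : normedModType K)
    (SS : completeNormedModType K) (j : {linear tensor X X -> SS}) x y :
  real_or_complex R K -> is_completion (@projective_norm K X X) j ->
  `|j (pure_tensor x y)| <= `|x| * `|y|.
Proof.
move=> hK [-> _]; rewrite /projective_norm /infimum; set E := [set _ | _ in _].
have Exy : E (`|x| * `|y|).
  by exists [:: (x, y)]; rewrite /= ?big_seq1.
case: eqP Exy => [->//|_ Exy].
have [|+ _] := xgetPex 0 (nonneg_infimums R K E hK (ex_intro _ _ Exy) _).
  by move=> _ [s _ <-]; apply: sumr_ge0 => p _; rewrite mulr_ge0.
exact.
Qed.

(** * Geometric bounds, filters and subsequences *)

Lemma real_or_complex_nat_bound (R : realType) (K : numFieldType) (x : K) :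
  real_or_complex R K -> 0 <= x -> exists N : nat, x <= N%:R.
Proof.
move=> hK x0; have x1 : 0 < x + 1 by rewrite ltr_wpDl.
have x1V : 0 < (x + 1)^-1 by rewrite invr_gt0.
have [N] := real_or_complex_archimedean R K (x + 1)^-1 hK x1V.
rewrite ltf_pV2 ?posrE// => /ltW xN; exists N.+1.
by rewrite (le_trans _ xN)// lerDl.
Qed.

Lemma sum_halves_le2 (K : numFieldType) N : \sum_(k < N) 2^-1 ^+ k <= 2 :> K.
Proof.
suff -> : \sum_(k < N) 2^-1 ^+ k = 2 - 2 * 2^-1 ^+ N :> K.
  by rewrite gerBl mulr_ge0// exprn_ge0// invr_ge0.
elim: N => [|N IHN]; first by rewrite big_ord0 expr0 mulr1 subrr.
rewrite big_ord_recr/= IHN exprS mulrA divff ?mul1r// -addrA; congr (_ + _).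
by rewrite mulr_natl mulr2n opprD subrK.
Qed.

Lemma halves_le (K : numFieldType) m n :
  (m <= n)%N -> 2^-1 ^+ n <= 2^-1 ^+ m :> K.
Proof. by move=> mn; rewrite ler_wiXn2l// ?invr_ge0// invf_le1// ler1n. Qed.

Lemma halves_lt_natV (K : numFieldType) n : 2^-1 ^+ n < n.+1%:R^-1 * 2 :> K.
Proof.
rewrite mulrC ltr_pdivlMr ?ltr0n// exprVn mulrC ltr_pdivrMr ?exprn_gt0//.
by rewrite -exprS -natrX ltr_nat ltn_expl.
Qed.

Lemma ltn_homo_ge (f : nat -> nat) k :
  {homo f : m n / (m < n)%N} -> (k <= f k)%N.
Proof. by move=> fi; elim: k => // k /leq_ltn_trans; apply; exact: fi. Qed.

Lemma filter_forall_lt (U : set_system nat) (P : nat -> set nat) n :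
  ProperFilter U -> (forall j, U (P j)) ->
  U [set m | forall j, (j < n)%N -> P j m].
Proof.
move=> FU UP; elim: n => [|n IHn]; first by apply: filterS filterT.
apply: filterS2 IHn (UP n) => m Pm Pnm j.
by rewrite ltnS leq_eqVlt => /predU1P[->|/Pm].
Qed.

(** The [U]-large set [P n] meets every tail, so a successor of [n] can be chosen in it; the
    subsequence iterates this choice. It serves to make each term small relative to data of its
    predecessor. *)
Lemma filter_subsequence (U : set_system nat) (P : nat -> set nat) :
  ProperFilter U -> (forall n, U [set m | (n < m)%N]) -> (forall n, U (P n)) ->
  exists phi, {homo phi : m n / (m < n)%N} /\
    forall k, P (phi k) (phi k.+1).
Proof.
move=> FU Uoo UP.
have /choice[g gP] n : exists m, (n < m)%N /\ P n m.
  by have [m []] := filter_ex (filterI (Uoo n) (UP n)); exists m.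
exists (fun k => iter k g 0%N); split=> [|k]; last first.
  by have [] := gP (iter k g 0%N).
apply: homo_ltn => [y x z|k]; first exact: ltn_trans.
by have [] := gP (iter k g 0%N).
Qed.

(** * Cesaro sums and boundedness of Banach-Saks sets *)

Lemma banach_saksP (K : numFieldType) (X : normedModType K) (A : set X)
    (x : nat -> X) : banach_saks A -> (forall n, A (x n)) ->
  exists phi z, {homo phi : m n / (m < n)%N} /\
    forall e : K, 0 < e -> exists N, forall n, (N <= n)%N ->
      `|\sum_(k < n) x (phi k) - n%:R *: z| <= n%:R * e.
Proof.
(* The mean of index [n] in [banach_saks] has [n.+1] terms, hence the threshold [N.+1] for sums of
   [n] terms. *)
move=> hA /hA[phi [phii /cvg_ex[z /cvgrPdist_le xz]]]; exists phi, z.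
split=> // e e0; have [N _ Nxz] := xz e e0; exists N.+1 => -[//|n].
rewrite ltnS => /Nxz /=.
rewrite -(ler_pM2l (ltr0Sn K n)); apply: le_trans.
rewrite -{2}(ger0_norm (ler0n K n.+1)) -normrZ scalerBr scalerA.
rewrite mulfV ?pnatr_eq0//.
by rewrite scale1r distrC.
Qed.

(** Two consecutive Cesaro sums differ by one term, which therefore grows at most linearly along the
    subsequence; in an unbounded set the terms can be chosen of norm beyond [n * n]. *)
Lemma banach_saks_bounded (R : realType) (K : numFieldType)
    (X : normedModType K) (A : set X) : real_or_complex R K -> banach_saks A ->
  exists M, forall x, A x -> `|x| <= M.
Proof.
move=> hK hA; apply: contrapT => /forallNP unb.
have /choice[x xP] n : exists x, A x /\ ~ (`|x| <= (n * n)%:R).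
  by have /existsNP[x /not_implyP] := unb (n * n)%:R; exists x.
have [phi [z [phii /(_ 1 ltr01)[N xN]]]] :=
  banach_saksP K X A x hA (fun n => (xP n).1).
have [m zm] := real_or_complex_nat_bound R K `|z| hK (normr_ge0 z).
(* With [n >= m + 3] the linear bound [n.+1 + n + m] is at most [n * n], and [n <= phi n]. *)
pose n := (N + m + 3)%N; have [_] := xP (phi n); apply.
have Nn : (N <= n)%N by rewrite /n -addnA leq_addr.
have -> : x (phi n) = (\sum_(k < n.+1) x (phi k) - n.+1%:R *: z)
    - (\sum_(k < n) x (phi k) - n%:R *: z) + z.
  rewrite big_ord_recr/= -[n.+1]addn1 natrD scalerDl scale1r.
  rewrite opprB opprD -!addrA [- z + _]addrCA addKr [- _ + z]addrC addKr.
  by rewrite addrCA subrr addr0.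
rewrite (le_trans (ler_normD _ _))//.
rewrite (le_trans (lerD (le_trans (ler_normB _ _)
  (lerD (xN _ (leqW Nn)) (xN _ Nn))) zm))//.
rewrite !mulr1 -!natrD ler_nat.
apply: leq_trans (leq_mul (ltn_homo_ge _ n phii) (ltn_homo_ge _ n phii)).
by rewrite /n; nia.
Qed.

Lemma c00_support_bound (K : numFieldType) (u : nat -> c00 K) :
  exists B : nat -> nat, [/\ {homo B : m n / (m <= n)%N},
    forall n, (n <= B n)%N & forall n j, (B n <= j)%N -> u n j = 0].
Proof.
have /choice[s sP] n := c00_bound K (u n).
exists (fun n => n + \sum_(l < n.+1) s l)%N; split=> [|n|n j Bj].
- apply: homo_leq => // [y x z|n]; first exact: leq_trans.
  by rewrite leq_add// [leqRHS]big_ord_recr leq_addr.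
- exact: leq_addr.
- apply: sP; apply: leq_trans Bj.
  by rewrite big_ord_recr/= addnA leq_addl.
Qed.

Lemma free_ultrafilter :
  exists2 U : set_system nat, UltraFilter U & forall n, U [set m | (n < m)%N].
Proof.
have [U [FU sU]] := ultraFilterLemma eventually_filter.
by exists U => // n; apply: sU; exact: nbhs_infty_gt.
Qed.

(** * Coordinates along a free ultrafilter *)

Section BanachSaks.
Variables (R : realType) (K : numFieldType) (hK : real_or_complex R K).
Variables (S : completeNormedModType K) (i : {linear c00 K -> S}).
Hypothesis hS : is_completion (@schreier_norm K) i.

Section Ultrafilter.
Variables (U : set_system nat) (FU : UltraFilter U).
Hypothesis Uoo : forall n, U [set m | (n < m)%N].

Lemma halves_ultra_lt e : 0 < e -> U [set n | 2^-1 ^+ n < e :> K].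
Proof.
move=> e0; have e20 : 0 < e / 2 by rewrite divr_gt0.
have [N Ne] := real_or_complex_archimedean R K (e / 2) hK e20.
apply: filterS (Uoo N) => n /= /ltnW Nn.
rewrite (le_lt_trans (halves_le K _ _ Nn))// (lt_trans (halves_lt_natV K N))//.
by rewrite -ltr_pdivlMr.
Qed.

(** [z] is the limit of the means of a subsequence whose coordinates converge fast to the
    ultrafilter limits [c], so [z] has coordinates [c]. Coordinates are read off finitely supported
    approximants: [w] of [x], and [u] of [x - z]. *)
Lemma banach_saks_coordinate_limit (A : set S) (x : nat -> S) :
  banach_saks A -> (forall n, A (x n)) ->
  exists z (u : nat -> c00 K), (forall n, `|x n - z - i (u n)| <= 2^-1 ^+ n) /\
    forall j e, 0 < e -> U [set n | `|u n j| < e].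
Proof.
move=> hA Ax; have [M AM] := banach_saks_bounded R K S A hK hA.
have half0 n : 0 < 2^-1 ^+ n :> K by rewrite exprn_gt0// invr_gt0.
have halfge0 n := ltW (half0 n).
have /choice[w wP] n : exists v, `|x n - i v| <= 2^-1 ^+ n.
  exact: completion_approx hS (half0 n).
have wM j n : `|w n j| <= M + 1.
  rewrite (le_trans (schreier_coord_le R K S i (w n) j hK hS))//.
  rewrite -[i _](subKr (x n)) (le_trans (ler_normB _ _))// lerD//.
    exact/AM/Ax.
  by rewrite (le_trans (wP n))// -(expr0 2^-1) halves_le.
have /choice[c cP] j :
    exists l, forall e, 0 < e -> U [set n | `|w n j - l| < e].
  exact: (ultra_limit R K U _ _ hK FU (wM j)).
have [|phi [phii phiP]] := filter_subsequence U (fun n =>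
    [set m | forall j, (j < n.+1)%N -> `|w m j - c j| < 2^-1 ^+ n]) _ Uoo.
  by move=> n; apply: filter_forall_lt => j; exact: cP.
have [psi [z [psii xz]]] := banach_saksP K S A (x \o phi) hA (fun n => Ax _).
pose f k := phi (psi k).
have fi : {homo f : m n / (m < n)%N} by move=> m n mn; exact/phii/psii.
(* The summand [D * 2 ^+ j] pays for indices [k <= j], where only the crude bound [D] may be
   available. Otherwise the predecessor in [phi] gives the rate, with a factor 2 for the shift by
   one. *)
have wc j : exists2 E, 0 <= E & forall k, `|w (f k) j - c j| <= E * 2^-1 ^+ k.
  pose D := M + 1 + `|c j|.
  have D0 : 0 <= D by rewrite addr_ge0// (le_trans _ (wM j 0%N)).
  exists (2 + D * 2 ^+ j) => [|k].
    by rewrite addr_ge0// mulr_ge0// exprn_ge0.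
  have kpsi := ltn_homo_ge psi k psii.
  have crude : (k <= j)%N -> `|w (f k) j - c j| <= (2 + D * 2 ^+ j) * 2^-1 ^+ k.
    move=> kj; rewrite (@le_trans _ _ D)//.
      by rewrite (le_trans (ler_normB _ _))// lerD.
    rewrite mulrDl -mulrA (@le_trans _ _ (D * (2 ^+ j * 2^-1 ^+ k)))//.
      rewrite ler_peMr// -(subnK kj) exprD -mulrA -exprMn divff// expr1n mulr1.
      by rewrite exprn_ege1// ler1n.
    by rewrite lerDr mulr_ge0.
  case psik : (psi k) => [|m].
    by apply: crude; rewrite (leq_trans kpsi)// psik.
  have [jm|mj] := ltnP j (phi m).+1; last first.
    apply: crude; apply: leq_trans mj.
    by rewrite (leq_trans kpsi)// psik ltnS; exact: ltn_homo_ge.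
  rewrite /f psik (le_trans (ltW (phiP m j jm)))//.
  rewrite (le_trans (halves_le K _ _ (ltn_homo_ge phi m phii)))//.
  rewrite mulrDl (@le_trans _ _ (2 * 2^-1 ^+ k))//; last first.
    by rewrite lerDl !mulr_ge0// exprn_ge0.
  have km : (k <= m.+1)%N by rewrite -psik.
  by rewrite -ler_pdivrMl// -exprS halves_le.
have /choice[u uP] n : exists v, `|x n - z - i v| <= 2^-1 ^+ n.
  exact: completion_approx hS (half0 n).
exists z, u; split=> // j.
have uw n : `|u n j| <= `|w n j - c j| + 2 * 2^-1 ^+ n.
  apply/ler_addgt0Pr => e e0; have e20 : 0 < e / 2 by rewrite divr_gt0.
  have [E E0 wE] := wc j.
  have [N0 xN] := xz _ e20.
  have [N1 EN] : exists N : nat, (2 + E * 2) / (e / 2) <= N%:R.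
    apply: real_or_complex_nat_bound hK _.
    by rewrite divr_ge0 ?(ltW e20)// addr_ge0// mulr_ge0.
  (* One [e / 2] covers the Cesaro error, valid from [N0] on; from [N1] on, the other absorbs the
     constant [2 + E * 2] after division by [N]. *)
  pose N := (N0 + N1).+1.
  have N00 : (N0 <= N)%N by rewrite /N -addnS leq_addr.
  have N11 : (N1 <= N)%N by rewrite /N -addSn leq_addl.
  have NN : 0 < N%:R :> K by rewrite ltr0n.
  (* Up to approximation errors, [T] is [N] times [(x n - z) - x n] plus a Cesaro sum close to [N]
     times [z], so its norm, and with it each coordinate, is small compared with [N]. *)
  pose T := N%:R *: (u n - w n) + \sum_(k < N) w (f k).
  have Tj : T j = N%:R * (u n j - w n j) + \sum_(k < N) w (f k) j.
    by rewrite -c00_sumE.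
  have iT : i T = (\sum_(k < N) x (f k) - N%:R *: z) -
      \sum_(k < N) (x (f k) - i (w (f k))) +
      N%:R *: ((x n - i (w n)) - (x n - z - i (u n))).
    rewrite linearD linearZ linearB linear_sum sumrB.
    have -> : x n - i (w n) - (x n - z - i (u n)) = z + (i (u n) - i (w n)).
      by rewrite !opprD !opprK -!addrA addrCA addNKr addrCA [- _ + _]addrC.
    set X := \sum_(k < N) x _; set W := \sum_(k < N) i _.
    rewrite scalerDr; set Q := _ *: (_ - _); set Z := _ *: z.
    rewrite opprB -!addrA [- X + _]addrCA [W + (Z + _)]addrCA addKr.
    by rewrite [W + _]addrCA addNKr addrC.
  have Tle : `|T j| <= N%:R * (e / 2) + 2 + N%:R * (2 * 2^-1 ^+ n).
    rewrite (le_trans (schreier_coord_le R K S i T j hK hS))// iT.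
    rewrite (le_trans (ler_normD _ _))// lerD//; last first.
      rewrite normrZ normr_nat ler_pM2l// (le_trans (ler_normB _ _))//.
      by rewrite mulr_natl mulr2n lerD.
    rewrite (le_trans (ler_normB _ _))// lerD//; first exact: xN.
    rewrite (le_trans (ler_norm_sum _ _ _))//.
    rewrite (le_trans _ (sum_halves_le2 K N))// ler_sum// => k _.
    by rewrite (le_trans (wP _))// halves_le// ltn_homo_ge.
  have uE : N%:R * u n j = T j + N%:R * (w n j - c j) -
      \sum_(k < N) (w (f k) j - c j).
    by rewrite Tj sumrB sumr_const card_ord -mulr_natl; ring.
  rewrite -(ler_pM2l NN) -{1}[N%:R]normr_nat -normrM uE.
  rewrite (le_trans (ler_normB _ _))//.
  have cle : `|\sum_(k < N) (w (f k) j - c j)| <= E * 2.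
    rewrite (le_trans (ler_norm_sum _ _ _))//.
    rewrite (@le_trans _ _ (\sum_(k < N) E * 2^-1 ^+ k))//.
      exact: ler_sum.
    by rewrite -mulr_sumr ler_wpM2l// sum_halves_le2.
  rewrite (le_trans (lerD (ler_normD _ _) cle))//.
  rewrite normrM normr_nat (le_trans (lerD (lerD Tle (lexx _)) (lexx _)))//.
  have EN' : 2 + E * 2 <= N%:R * (e / 2).
    by rewrite -ler_pdivrMr// (le_trans EN)// ler_nat.
  rewrite [leRHS](_ : _ = N%:R * (e / 2) + N%:R * (2 * 2^-1 ^+ n)
    + N%:R * `|w n j - c j| + N%:R * (e / 2)); last by field.
  rewrite [leLHS](_ : _ = N%:R * (e / 2) + N%:R * (2 * 2^-1 ^+ n)
    + N%:R * `|w n j - c j| + (2 + E * 2)); last by ring.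
  by rewrite lerD2l.
move=> e e0; have e20 : 0 < e / 2 by rewrite divr_gt0.
have e40 : 0 < e / 2 / 2 by rewrite divr_gt0.
apply: filterS2 (cP j _ e20) (halves_ultra_lt _ e40) => n /= nc ne.
rewrite (le_lt_trans (uw n))// [ltRHS]splitr ltrD//.
by rewrite mulrC -ltr_pdivlMr.
Qed.

Lemma banach_saks_sup_norm_null (A : set S) (x : nat -> S) (z : S)
    (u : nat -> c00 K) :
  banach_saks A -> (forall n, A (x n)) ->
  (forall n, `|x n - z - i (u n)| <= 2^-1 ^+ n) ->
  (forall j e, 0 < e -> U [set n | `|u n j| < e]) ->
  forall d, 0 < d -> U [set n | forall j, `|u n j| < d].
Proof.
move=> hA Ax xu u0 d d0.
have [//|Ud] := in_ultra_setVsetC [set n | forall j, `|u n j| < d] FU.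
exfalso.
have [B [Bmono nB uB]] := c00_support_bound K u.
(* This margin is chosen so that [M.*2] errors of this size for [n = M] add up to at most
   [d / 2]. *)
have small0 n : 0 < d / (4 * n.+1%:R) by rewrite divr_gt0 ?mulr_gt0 ?ltr0n.
have small_le m n : (m <= n)%N -> d / (4 * n.+1%:R) <= d / (4 * m.+1%:R).
  move=> mn; rewrite ler_pM2l// lef_pV2 ?posrE ?mulr_gt0 ?ltr0n//.
  by rewrite ler_pM2l// ler_nat.
have [|phi [phii phiP]] := filter_subsequence U (fun n => [set m |
    (forall j, (j < B n)%N -> `|u m j| < d / (4 * n.+1%:R)) /\
    ~ (forall j, `|u m j| < d)]) _ Uoo.
  by move=> n; apply: filterI => //; apply: filter_forall_lt => j; exact: u0.
have /choice[J JP] k : exists j, d <= `|u (phi k.+1) j|.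
  have [_ /existsNP[j /negP uj]] := phiP k; exists j.
  by move: uj; rewrite -real_leNgt// ger0_real// ltW.
have [psi [z' [psii xz']]] :=
  banach_saksP K S A (x \o (fun k => phi k.+1)) hA (fun n => Ax _).
(* The shift by one gives [f k] the predecessor [phi (psi k)]: [u (f k)] is small below
   [B (phi (psi k))], and its coordinate [Jf k] has size at least [d]. *)
pose f k := phi (psi k).+1; pose Jf k := J (psi k).
have fi : {homo f : m n / (m < n)%N}.
  by move=> m n mn; apply: phii; rewrite ltnS psii.
have fle l k : (l < k)%N -> (f l <= phi (psi k))%N.
  move=> /psii; rewrite leq_eqVlt => /predU1P[lk|/phii/ltnW//].
  by rewrite /f lk.
have JfB k : (Jf k < B (f k))%N.
  rewrite ltnNge; apply/negP => /uB uJ; have := JP (psi k).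
  by rewrite uJ normr0 (lt_geF d0).
have BJf l k : (l < k)%N -> (B (f l) <= Jf k)%N.
  move=> lk; rewrite leqNgt; apply/negP => JfBl.
  have [+ _] := phiP (psi k).
  move=> /(_ _ (leq_trans JfBl (Bmono _ _ (fle _ _ lk)))) Jsmall.
  have := le_lt_trans (JP (psi k)) Jsmall.
  apply/negP; rewrite -real_leNgt ?realE ?(ltW d0) ?(ltW (small0 _))//.
  rewrite ler_pdivrMr ?mulr_gt0 ?ltr0n// ler_peMr ?(ltW d0)//.
  by rewrite -natrM ler1n.
(* For [l < k] the coordinate [Jf k] is past the support of [u (f l)]. For [l > k] it lies in the
   range where [u (f l)] was chosen small. *)
have usmall l k M : (M <= k)%N -> l != k ->
    `|u (f l) (Jf k)| <= d / (4 * M.+1%:R).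
  move=> Mk; rewrite neq_ltn => /orP[/BJf/uB->|kl].
    by rewrite normr0 ltW.
  have [+ _] := phiP (psi l).
  move=> /(_ _ (leq_trans (JfB k) (Bmono _ _ (fle _ _ kl)))).
  move=> /ltW/le_trans; apply.
  apply: small_le; apply: leq_trans (ltn_homo_ge phi _ phii).
  by rewrite (leq_trans Mk)// (leq_trans (ltnW kl))// ltn_homo_ge.
(* The Cesaro errors of order [M.*2] once and of order [M] twice add up to [4 * M * (d / 16)]. *)
have e0 : 0 < d / 16 by rewrite divr_gt0.
have [N0 xN] := xz' _ e0.
(* The final contradiction needs [M * (d / 4) > 2], that is [M > 8 / d]; [25 / d] is ample. *)
have [N1 dN1] : exists N : nat, 25 / d <= N%:R.
  by apply: (real_or_complex_nat_bound R K _ hK); rewrite divr_ge0// ltW.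
pose M := (N0 + N1).+1.
(* With these signs the sum is [M.*2] times the difference of the means of orders [M.*2] and [M],
   and constant vectors cancel. *)
pose a l : K := if (l < M)%N then -1 else 1.
have a1 l : `|a l| = 1 by rewrite /a; case: ifP => _; rewrite ?normrN normr1.
pose T := \sum_(l < M.*2) a l *: u (f l).
have Tj j : T j = \sum_(l < M.*2) a l * u (f l) j.
  by rewrite c00_sumE; apply: eq_bigr.
have sumaE (F : nat -> S) : \sum_(l < M.*2) a l *: F l =
    \sum_(l < M.*2) F l - (\sum_(l < M) F l + \sum_(l < M) F l).
  rewrite -addnn !big_split_ord/= opprD addrACA subrr add0r.
  rewrite addrC; congr (_ + _).
    by apply: eq_bigr => l _; rewrite /a ltnNge leq_addr/= scale1r.
  by rewrite -sumrN; apply: eq_bigr => l _; rewrite /a ltn_ord scaleN1r.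
have iT : i T = (\sum_(l < M.*2) x (f l) - M.*2%:R *: z') -
    (\sum_(l < M) x (f l) - M%:R *: z') - (\sum_(l < M) x (f l) - M%:R *: z')
    - \sum_(l < M.*2) a l *: (x (f l) - z - i (u (f l))).
  have suma0 (c : S) : \sum_(l < M.*2) a l *: c = 0.
    by rewrite (sumaE (fun=> c)) !sumr_const !card_ord -mulrnDr addnn subrr.
  have -> : i T = \sum_(l < M.*2) a l *: (x (f l) - z')
      - \sum_(l < M.*2) a l *: (x (f l) - z - i (u (f l))).
    transitivity (\sum_(l < M.*2) a l *: (x (f l) - z')
        + \sum_(l < M.*2) a l *: (z' - z)
        - \sum_(l < M.*2) a l *: (x (f l) - z - i (u (f l)))); last first.
      by rewrite suma0 addr0.
    rewrite -big_split -sumrB linear_sum; apply: eq_bigr => l _.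
    by rewrite linearZ/= -!scalerDr -scalerN -scalerDr addrA subrK subKr.
  rewrite (sumaE (fun l => x (f l) - z')) !sumrB !sumr_const !card_ord.
  rewrite !scaler_nat; congr (_ - _).
  by rewrite [- (_ + (_ - _))]opprD [LHS]addrA.
have iTle : `|i T| <= M%:R * (d / 4) + 2.
  rewrite iT (le_trans (ler_normB _ _))// lerD//; last first.
    rewrite (le_trans (ler_norm_sum _ _ _))//.
    rewrite (le_trans _ (sum_halves_le2 K M.*2))// ler_sum// => l _.
    by rewrite normrZ a1 mul1r (le_trans (xu _))// halves_le// ltn_homo_ge.
  have MN0 : (N0 <= M)%N by rewrite /M -addnS leq_addr.
  have M2N0 : (N0 <= M.*2)%N by rewrite -addnn (leq_trans MN0)// leq_addr.
  rewrite (le_trans (ler_normB _ _))//.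
  rewrite (le_trans (lerD (ler_normB _ _) (lexx _)))//.
  rewrite (le_trans (lerD (lerD (xN _ M2N0) (xN _ MN0)) (xN _ MN0)))//.
  rewrite -addnn natrD le_eqVlt; apply/orP; left; apply/eqP.
  field=> //.
have Tge k : (M <= k < M.*2)%N -> d / 2 <= `|T (Jf k)|.
  move=> /andP[Mk kM2]; rewrite Tj (bigD1 (Ordinal kM2))//=.
  rewrite -[X in X <= _](addrK (d / 2)) -splitr (le_trans _ (lerB_normD _ _))//.
  rewrite lerB ?normrM ?a1 ?mul1r//; first exact: JP.
  rewrite (le_trans (ler_norm_sum _ _ _))//.
  rewrite (@le_trans _ _ (\sum_(l < M.*2) d / (4 * M.+1%:R)))//.
    rewrite [leRHS](bigID (fun l => l != Ordinal kM2))/= ler_wpDr ?sumr_ge0//.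
      by move=> l _; exact: ltW.
    by apply: ler_sum => l lk; rewrite normrM a1 mul1r usmall.
  have -> : d / 2 = M.+1.*2%:R * (d / (4 * M.+1%:R)).
    rewrite -muln2 natrM; have : M.+1%:R != 0 :> K by rewrite pnatr_eq0.
    by move: M.+1%:R => y y0; field.
  rewrite sumr_const card_ord -[_ *+ M.*2]mulr_natl ler_pM2r//.
  by rewrite ler_nat leq_double.
have Jinc : {homo Jf : m n / (m < n)%N}.
  by move=> m n mn; rewrite (leq_trans (JfB m))// BJf.
(* These [M] positions form an admissible set, since [Jf k] is at least [k - 1] and [k >= M]. *)
pose s := [seq Jf k | k <- index_iota M M.*2].
have sM : size s = M by rewrite size_map size_iota -addnn addKn.
have us : uniq s.
  rewrite map_inj_uniq ?iota_uniq// => m n Jmn; apply/eqP.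
  rewrite eqn_leq; apply/andP.
  by split; rewrite leqNgt; apply/negP => /Jinc; lia.
have : \sum_(j <- s) `|T j| <= M%:R * (d / 4) + 2.
  apply: le_trans iTle; apply: (schreier_sum_le R K S i s T hK hS us) => n.
  rewrite sM => /mapP[k]; rewrite mem_index_iota => /andP[Mk _] ->.
  rewrite (leq_trans Mk)//; case: k Mk => // k _.
  rewrite ltnS (leq_trans _ (BJf _ _ (ltnSn k)))//.
  by rewrite (leq_trans _ (nB _))// ltn_homo_ge.
apply/negP; rewrite big_map -real_ltNge ?realE; last 2 first.
- by rewrite addr_ge0// mulr_ge0// divr_ge0// ltW.
- by rewrite sumr_ge0.
apply: (@lt_le_trans _ _ (\sum_(M <= k < M.*2) d / 2)); last exact: ler_sum_nat.
rewrite sumr_const_nat -addnn addKn -[d / 2 *+ M]mulr_natl.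
have -> : M%:R * (d / 2) = M%:R * (d / 4) + M%:R * (d / 4) by field.
rewrite ltrD2l mulrA ltr_pdivlMr// -ltr_pdivrMr//.
rewrite (@lt_le_trans _ _ (25 / d))//.
  by rewrite ltr_pM2r ?invr_gt0// -natrM ltr_nat.
by rewrite (le_trans dN1)// ler_nat /M -addSn leq_addl.
Qed.

End Ultrafilter.

(** * Sums behaving like those of the basis of [c_0] *)

Lemma schreier_unconditional_sum (v : nat -> c00 K) (B : nat -> nat)
    (D : K) (N : nat) (a : nat -> K) :
  (forall k, `|i (v k)| <= D) ->
  (forall k j, (B k <= j)%N -> v k j = 0) ->
  (forall l k j, (l < k)%N ->
    `|v k j| <= (2 * 2^-1 ^+ k) / (B l).+1%:R) ->
  (forall k, `|a k| <= 1) ->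
  `|i (\sum_(k < N) a k *: v k)| <= D + 4.
Proof.
move=> vD vB vsmall a1.
have D0 : 0 <= D by rewrite (le_trans _ (vD 0%N)).
have half0 n : 0 <= 2 * 2^-1 ^+ n :> K.
  by rewrite mulr_ge0// exprn_ge0// invr_ge0.
apply: (schreier_norm_le R K S i _ _ hK hS) => A adA.
have sumA_le (k : nat) : \sum_(j <- A) `|v k j| <= D.
  rewrite (le_trans _ (vD k))//.
  by apply: (schreier_sum_le R K S i A (v k) hK hS) => //; exact: fset_uniq.
(* [l] is the first index with [#|A| <= B l]: the [v k] with [k < l] vanish on
   [A], and [#|A|] times the sup norm of [v k] is small for [k > l]. *)
have [l lP] : exists l : nat, forall k, \sum_(j <- A) `|v k j| <=
    (if k == l then D else 0) + 2 * 2^-1 ^+ k.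
  have v0 k : (B k < #|` A|)%N -> \sum_(j <- A) `|v k j| = 0.
    move=> BkA; rewrite big_seq big1// => j /adA jA.
    by rewrite vB ?normr0// -ltnS (leq_trans BkA).
  have [|] := pselect (exists l, (#|` A| <= B l)%N); last first.
    move=> /forallNP AB; exists 0%N => k; rewrite v0 ?addr_ge0//.
      by case: ifP.
    by rewrite ltnNge; apply/negP.
  move=> exl; case: (ex_minnP exl) => l Al lmin; exists l; move=> k.
  have [kl|lk|kl] := ltngtP k l.
  - by rewrite v0 ?add0r// ltnNge; apply/negP => /lmin; rewrite leqNgt kl.
  - rewrite add0r (@le_trans _ _ (\sum_(j <- A) 2 * 2^-1 ^+ k / (B l).+1%:R))//.
      by apply: ler_sum => j _; exact: vsmall.
    rewrite big_const_seq count_predT iter_addr_0 -[_ *+ size A]mulr_natl mulrCA.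
    rewrite ler_piMr// ler_pdivrMr ?ltr0n// mul1r ler_nat.
    by rewrite (leq_trans Al).
  - by rewrite (le_trans (sumA_le k))// lerDl.
apply: (@le_trans _ _ (\sum_(k < N) \sum_(j <- A) `|v k j|)).
  rewrite exchange_big/=; apply: ler_sum => j _.
  rewrite c00_sumE (le_trans (ler_norm_sum _ _ _))//; apply: ler_sum => k _.
  by rewrite [X in `|X|](_ : _ = a k * v k j)// normrM ler_piMl.
rewrite (le_trans (ler_sum _ (fun k _ => lP _)))//.
(* The index [l] costs [D], and the geometric terms together cost at most [2 * 2]. *)
rewrite big_split/= lerD//.
  rewrite -big_mkcond/=; have [lN|Nl] := ltnP l N.
    by rewrite (big_pred1 (Ordinal lN)).
  by rewrite big_pred0// => k; apply/negbTE; rewrite neq_ltn (leq_trans _ Nl).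
rewrite -mulr_sumr; have -> : 4 = 2 * 2 :> K by rewrite -natrM.
rewrite ler_pM2l//.
exact: sum_halves_le2.
Qed.

(** The bound is uniform over further subsequences [psi], so that it survives a second extraction
    made for another sequence. *)
Lemma banach_saks_unconditional (A : set S) (x : nat -> S) :
  banach_saks A -> (forall n, A (x n)) ->
  exists z phi C, {homo phi : m n / (m < n)%N} /\
    forall psi, {homo psi : m n / (m < n)%N} ->
    forall N (a : nat -> K), (forall k, `|a k| <= 1) ->
    `|\sum_(k < N) a k *: (x (phi (psi k)) - z)| <= C.
Proof.
move=> hA Ax; have [U FU Uoo] := free_ultrafilter.
have [z [u [xu u0]]] := banach_saks_coordinate_limit U FU Uoo A x hA Ax.
have usup := banach_saks_sup_norm_null U FU Uoo A x z u hA Ax xu u0.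
have [B [Bmono nB uB]] := c00_support_bound K u.
have [M AM] := banach_saks_bounded R K S A hK hA.
have [|phi [phii phiP]] := filter_subsequence U (fun n => [set m |
    forall j, `|u m j| < 2^-1 ^+ n / (B n).+1%:R]) _ Uoo.
  by move=> n; apply: usup; rewrite divr_gt0// exprn_gt0// invr_gt0.
(* [M + |z| + 1] bounds the norms of the approximants, [4] comes from their unconditional sums, and
   [2] is the total approximation error. *)
exists z, phi, (M + `|z| + 1 + 4 + 2); split=> // psi psii N a a1.
pose f k := phi (psi k).
have fi : {homo f : m n / (m < n)%N} by move=> m n mn; exact/phii/psii.
have -> : \sum_(k < N) a k *: (x (phi (psi k)) - z) =
    i (\sum_(k < N) a k *: u (f k)) +
    \sum_(k < N) a k *: (x (f k) - z - i (u (f k))).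
  rewrite linear_sum -big_split; apply: eq_bigr => k _ /=.
  by rewrite linearZ -scalerDr [i _ + _]addrC subrK.
rewrite (le_trans (ler_normD _ _))// lerD//; last first.
  rewrite (le_trans (ler_norm_sum _ _ _))// (le_trans _ (sum_halves_le2 K N))//.
  apply: ler_sum => k _; rewrite normrZ -[leRHS]mul1r ler_pM//.
  by rewrite (le_trans (xu _))// halves_le// ltn_homo_ge.
apply: (schreier_unconditional_sum (u \o f) (B \o f)) => //= [k|k j|l k j lk].
- rewrite -[i _](subKr (x (f k) - z)) (le_trans (ler_normB _ _))// lerD//.
    by rewrite (le_trans (ler_normB _ _))// lerD//; exact/AM/Ax.
  by rewrite (le_trans (xu _))// -(expr0 2^-1) halves_le.
- exact: uB.
- have kpsi := ltn_homo_ge psi k psii.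
  have lpsi := psii _ _ lk.
  (* As [psi l < psi k], the index [psi k] has a predecessor [m >= psi l]; smallness relative to
     [phi m] gives smallness relative to [f l], the shift costing a factor 2. *)
  rewrite /f; case psik : (psi k) lpsi kpsi => [//|m]; rewrite ltnS => lm km.
  rewrite (le_trans (ltW (phiP m j)))// ler_pM ?exprn_ge0 ?invr_ge0 ?ler0n//.
    rewrite -ler_pdivrMl// -exprS halves_le// (leq_trans km)// ltnS.
    exact: ltn_homo_ge.
  rewrite lef_pV2 ?posrE ?ltr0n// ler_nat ltnS Bmono//.
  by move: lm; rewrite leq_eqVlt => /predU1P[->//|/phii/ltnW].
Qed.

End BanachSaks.

(** * Averaging over signs for bilinear maps *)

Lemma bilinear_sum_le (K : numFieldType) (X Y Z : normedModType K)
    (b : X -> Y -> Z) :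
  (forall x x' y, b (x + x') y = b x y + b x' y) ->
  (forall x y y', b x (y + y') = b x y + b x y') ->
  (forall x y, `|b x y| <= `|x| * `|y|) ->
  forall (u : nat -> X) (v : nat -> Y) C D N p q,
  (forall a : nat -> K, (forall k, `|a k| <= 1) ->
    `|p + \sum_(k < N) a k *: u k| <= C) ->
  (forall a : nat -> K, (forall k, `|a k| <= 1) ->
    `|q + \sum_(k < N) a k *: v k| <= D) ->
  `|b p q + \sum_(k < N) b (u k) (v k)| <= C * D.
Proof.
move=> bDl bDr ble u v C D; elim=> [|N IHN] p q pC qD.
  have a1 (k : nat) : `|0 : K| <= 1 by rewrite normr0.
  have := pC (fun=> 0) a1; have := qD (fun=> 0) a1; rewrite !big_ord0 !addr0.
  by move=> qD0 pC0; rewrite (le_trans (ble _ _))// ler_pM.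
(* The vectors [p] and [q] are there for the induction: each absorbs its last term with a common
   sign [s], and the mean over both signs kills the cross terms. *)
have ext (W : normedModType K) (w : nat -> W) r E (s : K) : `|s| <= 1 ->
    (forall a : nat -> K, (forall k, `|a k| <= 1) ->
      `|r + \sum_(k < N.+1) a k *: w k| <= E) ->
    forall a : nat -> K, (forall k, `|a k| <= 1) ->
      `|(r + s *: w N) + \sum_(k < N) a k *: w k| <= E.
  move=> s1 rE a a1.
  have := rE (fun k => if k == N then s else a k); rewrite big_ord_recr/= eqxx.
  rewrite [X in `|r + (X + _)|](_ : _ = \sum_(k < N) a k *: w k); last first.
    by apply: eq_bigr => k _; rewrite ltn_eqF.
  by rewrite [_ + s *: _]addrC addrA; apply => k; case: ifP.
have s1 : `|1 : K| <= 1 by rewrite normr1.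
have sN1 : `|-1 : K| <= 1 by rewrite normrN normr1.
have Hp := IHN _ _ (ext _ _ _ _ _ s1 pC) (ext _ _ _ _ _ s1 qD).
have Hm := IHN _ _ (ext _ _ _ _ _ sN1 pC) (ext _ _ _ _ _ sN1 qD).
have b0l y : b 0 y = 0 by apply: (addrI (b 0 y)); rewrite -bDl !addr0.
have b0r x : b x 0 = 0 by apply: (addrI (b x 0)); rewrite -bDr !addr0.
have bNl x y : b (- x) y = - b x y.
  by apply: (addrI (b x y)); rewrite -bDl !subrr b0l.
have bNr x y : b x (- y) = - b x y.
  by apply: (addrI (b x y)); rewrite -bDr !subrr b0r.
(* [2 (p ⊗ q + u ⊗ v) = (p + u) ⊗ (q + v) + (p - u) ⊗ (q - v)] *)
rewrite -(ler_pM2l (ltr0Sn K 1)) -{1}[2]normr_nat -normrZ.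
rewrite mulr_natl [leRHS]mulr2n (le_trans _ (lerD Hp Hm))//.
rewrite (le_trans _ (ler_normD _ _))// le_eqVlt; apply/orP; left; apply/eqP.
congr (`|_|); rewrite !scale1r !scaleN1r !bDl !bDr !bNl !bNr !opprK.
rewrite scaler_nat mulr2n big_ord_recr/=.
set Q := \sum_(_ < _) _; set s := b p q; set t := b (u N) (v N).
set x := b p _; set y := b _ q.
rewrite [RHS]addrACA [X in _ = X + _]addrACA [s + x + _]addrACA.
rewrite [y + t + _]addrACA !subrr addr0 add0r [LHS]addrACA.
by rewrite [Q + t + _]addrACA [Q + Q + _]addrC addrA.
Qed.

Lemma pure_tensorDl (K : numFieldType) (X Y : normedModType K) (x x' : X)
    (y : Y) :
  pure_tensor (x + x') y = pure_tensor x y + pure_tensor x' y.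
Proof.
by apply: val_inj; apply/funext => f; rewrite /= /eval_form linearDl.
Qed.

Lemma pure_tensorDr (K : numFieldType) (X Y : normedModType K) (x : X)
    (y y' : Y) :
  pure_tensor x (y + y') = pure_tensor x y + pure_tensor x y'.
Proof.
by apply: val_inj; apply/funext => f; rewrite /= /eval_form linearDr.
Qed.

(** * Cesaro means of elementary tensors *)

Theorem mainTheorem7 (R : realType) (K : numFieldType)
    (hK : real_or_complex R K)
    (S : completeNormedModType K) (i : {linear c00 K -> S})
    (hS : is_completion (@schreier_norm K) i)
    (SS : completeNormedModType K) (j : {linear tensor S S -> SS})
    (hSS : is_completion (@projective_norm K S S) j)
    (A B : set S) (hA : banach_saks A) (hB : banach_saks B) :
  banach_saks [set j (pure_tensor a b) | a in A & b in B].
Proof.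
move=> xy xyAB.
have /choice[x xP] n :
    exists x, A x /\ exists2 y, B y & j (pure_tensor x y) = xy n.
  by have [x Ax [y By E]] := xyAB n; exists x; split=> //; exists y.
have Ax n := (xP n).1.
have /choice[y yP] n : exists y, B y /\ j (pure_tensor (x n) y) = xy n.
  by have [_ [y By E]] := xP n; exists y.
have [z [phi [C [phii xC]]]] :=
  banach_saks_unconditional R K hK S i hS A x hA Ax.
(* The second extraction is made inside the first; the bound for [x] persists along [psi]. *)
have [t [psi [D [psii yD]]]] := banach_saks_unconditional R K hK S i hS B
  (y \o phi) hB (fun n => (yP _).1).
pose f k := phi (psi k); exists f; split=> [m n mn|]; first exact/phii/psii.
pose b a c := j (pure_tensor a c).
have bDl a a' c : b (a + a') c = b a c + b a' c.
  by rewrite /b pure_tensorDl linearD.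
have bDr a c c' : b a (c + c') = b a c + b a c'.
  by rewrite /b pure_tensorDr linearD.
have ble a c : `|b a c| <= `|a| * `|c|.
  exact: (projective_pure_le R K S SS j a c hK hSS).
have a1 (k : nat) : `|1 : K| <= 1 by rewrite normr1.
have xC1 N : `|\sum_(k < N) (x (f k) - z)| <= C.
  have := xC psi psii N (fun=> 1) a1.
  by under eq_bigr do rewrite scale1r.
have yD1 N : `|\sum_(k < N) (y (f k) - t)| <= D.
  have := yD id (fun m n => id) N (fun=> 1) a1.
  by under eq_bigr do rewrite scale1r.
have b0l c : b 0 c = 0 by apply: (addrI (b 0 c)); rewrite -bDl !addr0.
have b0r a : b a 0 = 0 by apply: (addrI (b a 0)); rewrite -bDr !addr0.
have bsuml N (F : nat -> S) c : b (\sum_(k < N) F k) c = \sum_(k < N) b (F k) c.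
  by elim/big_ind2 : _ => // a r a' r' <- <-.
have bsumr N (F : nat -> S) a : b a (\sum_(k < N) F k) = \sum_(k < N) b a (F k).
  by elim/big_ind2 : _ => // c r c' r' <- <-.
pose M := C * D + (C * `|t| + `|z| * D).
have sum_le N : `|\sum_(k < N) xy (f k) - N%:R *: b z t| <= M.
  (* Termwise, [x ⊗ y - z ⊗ t = (x - z) ⊗ (y - t) + (x - z) ⊗ t + z ⊗ (y - t)]; the last two are
     summed inside the tensor. *)
  have -> : \sum_(k < N) xy (f k) - N%:R *: b z t =
      \sum_(k < N) b (x (f k) - z) (y (f k) - t) +
      (b (\sum_(k < N) (x (f k) - z)) t + b z (\sum_(k < N) (y (f k) - t))).
    rewrite (bsuml _ (fun k => x (f k) - z)) (bsumr _ (fun k => y (f k) - t)).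
    rewrite scaler_nat -[X in _ *+ X]card_ord -sumr_const -sumrB -!big_split.
    apply: eq_bigr => k _ /=; have [_ <-] := yP (f k); rewrite -/(b _ _).
    rewrite -[x (f k)](subrK z) -[y (f k)](subrK t) !addrK.
    move: (x (f k) - z) (y (f k) - t) => a c.
    by rewrite bDl !bDr -!addrA subrr addr0.
  rewrite (le_trans (ler_normD _ _))// lerD//.
    have := bilinear_sum_le K S S SS b bDl bDr ble
      (fun k => x (f k) - z) (fun k => y (f k) - t) C D N 0 0.
    rewrite b0l add0r; apply=> a al; rewrite add0r; first exact: (xC psi psii).
    exact: (yD id (fun m n => id)).
  rewrite (le_trans (ler_normD _ _))// lerD// (le_trans (ble _ _))//.
    by rewrite ler_wpM2r.
  by rewrite ler_wpM2l.
have M0 : 0 <= M by rewrite (le_trans _ (sum_le 0%N)).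
apply/cvg_ex; exists (b z t); apply/cvgrPdist_le => e e0.
(* [M] does not depend on the number of terms, so dividing by it makes the deviation from [b z t]
   tend to 0. *)
have [N MN] := real_or_complex_nat_bound R K (M / e) hK (divr_ge0 M0 (ltW e0)).
exists N => // n /= Nn.
rewrite -(ler_pM2l (ltr0Sn K n)) -{1}[n.+1%:R]normr_nat -normrZ scalerBr scalerA.
rewrite mulfV ?pnatr_eq0// scale1r distrC (le_trans (sum_le _))//.
by rewrite -ler_pdivrMr// (le_trans MN)// ler_nat leqW.
Qed.
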